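(* Let $f:\{0,1\}^n\times\{0,1\}^n\to\{0,1\}^m$ be any function and let $\alpha\in\mathbb{N}$ with $\alpha\le m$. Then there exist two (jointly distributed) random variables $X$ and $Y$ taking values in $\{0,1\}^n$ such that $$H_\infty(X)\ge n-\alpha,\quad H_\infty(Y)\ge n-\alpha,\quad H_\infty(X,Y)\ge 2n-\alpha,\quad H_\infty(f(X,Y))\le m-\alpha.$$
   Context: For a random variable $Z$ with finite range, the min-entropy is $H_\infty(Z)=\min_{a:\Pr[Z=a]>0}\log_2(1/\Pr[Z=a])$; $H_\infty(X,Y)$ is the min-entropy of the pair $(X,Y)$. *)

(* Defs.v *)
From HB Require Import structures.
From mathcomp Require Import all_boot all_order all_algebra.
From mathcomp Require Import all_classical all_reals all_analysis.

Set Implicit Arguments.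
Unset Strict Implicit.
Unset Printing Implicit Defensive.

Import Order.TTheory GRing.Theory Num.Theory.
Import numFieldNormedType.Exports.

Local Open Scope classical_set_scope.
Local Open Scope ring_scope.

Definition log2 (R : realType) (x : R) : R := ln x / ln 2.

Definition prob_eq d (T : measurableType d) (R : realType)
    (P : probability T R) (A : finType) (Z : T -> A) (a : A) : R :=
  fine (P (Z @^-1` [set a])).

(* The value +oo is only the neutral element of the minimum: some outcome always
   has positive probability when the events Z = a are measurable, so the minimum
   is a real number attained at such an outcome (min_entropy_attained). *)
Definition min_entropy d (T : measurableType d) (R : realType)
    (P : probability T R) (A : finType) (Z : T -> A) : \bar R :=
  \big[mine/+oo%E]_(a : A | 0 < prob_eq P Z a) (log2 (1 / prob_eq P Z a))%:E.

(* The product sigma-algebra on bit strings is discrete, so every function of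
   random bit strings X and Y is again a random variable. *)
Lemma measurable_bitstrings n (B : set (n.-tuple bool)) : measurable B.
Proof.
have m1 (t : n.-tuple bool) : measurable [set t].
  have -> : [set t] = \bigcap_(i in [set: 'I_n])
      ((fun s : n.-tuple bool => tnth s i) @^-1` [set tnth t i]).
    apply/seteqP; split => [s -> //|s st].
    by apply: eq_from_tnth => i; exact: st.
  apply: fin_bigcap_measurable => [|i _]; first exact: finite_finset.
  by rewrite -[X in measurable X]setTI; exact: measurable_tnth.
have -> : B = \bigcup_(t in B) [set t].
  by apply/seteqP; split => [t Bt|t [s Bs ->]//]; exists t.
by apply: fin_bigcup_measurable => [|t _]; [exact: finite_finset|exact: m1].
Qed.

Lemma min_entropy_attained d (T : measurableType d) (R : realType)
    (P : probability T R) (A : finType) (Z : T -> A)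
    (mZ : forall a, measurable (Z @^-1` [set a])) :
  exists2 a, 0 < prob_eq P Z a &
    min_entropy P Z = (log2 (1 / prob_eq P Z a))%:E.
Proof.
have [a0 a0P] : exists a, 0 < prob_eq P Z a.
  apply: contrapT => /forallNP PZ.
  have P0 a : P (Z @^-1` [set a]) = 0%E.
    rewrite -(fineK (fin_num_measure P _ (mZ a))); congr (_%:E).
    apply/eqP; rewrite eq_le fine_ge0 // andbT leNgt.
    by apply/negP; exact: PZ.
  have : P setT = 0%E.
    have -> : setT = \bigcup_(a in [set: A]) (Z @^-1` [set a]).
      by apply/seteqP; split => // w _; exists (Z w).
    rewrite measure_fin_bigcup //.
    - by apply: fsbig1 => a _; exact: P0.
    - exact: finite_finset.
    - by move=> a b _ _ [w [/= <- <-]].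
  by rewrite probability_setT => /eqP; rewrite onee_eq0.
have [i iP eqi] := eq_bigmin (x := +oo%E) a0 (fun a => 0 < prob_eq P Z a)
  (fun a => (log2 (1 / prob_eq P Z a))%:E) a0P (fun a _ => leey _).
by exists i.
Qed.

(* Main.v *)
(* A most popular value of f has a fibre S with at least 2^(2n-m) points.  Take
   (X, Y) uniform on a set W containing S, where W = S if S already has
   2^(2n-alpha) points and |W| = 2^(2n-alpha) otherwise.  Every pair then has
   probability at most 2^(alpha-2n), hence, summing over the other coordinate,
   every value of X or of Y has probability at most 2^(alpha-n), while f(X, Y)
   hits the popular value with probability |S| / |W| >= 2^(alpha-m). *)

Require Import Defs.
From HB Require Import structures.
From mathcomp Require Import all_boot all_order all_algebra.
From mathcomp Require Import all_classical all_reals all_analysis.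

Set Implicit Arguments.
Unset Strict Implicit.
Unset Printing Implicit Defensive.

Import Order.TTheory GRing.Theory Num.Theory.
Import numFieldNormedType.Exports.

Local Open Scope ring_scope.

(** The law is the average of the Dirac masses at the points of [W]. Quantifying over every [Z]
    reduces all four entropy bounds to counting points of [W]. *)
Lemma exists_uniform_probability (R : realType) (n : nat)
    (W : {set n.-tuple bool * n.-tuple bool}) (W0 : (0 < #|W|)%N) :
  exists P : probability (n.-tuple bool * n.-tuple bool)%type R,
    forall (B : finType) (Z : n.-tuple bool * n.-tuple bool -> B) b,
      prob_eq P Z b = #|[set w in W | Z w == b]|%:R / #|W|%:R.
Proof.
have [w0 w0W] : exists w, w \in W by apply/set0Pn; rewrite -card_gt0.
pose k := #|W|.
have ck : 0 <= k%:R^-1 :> R by rewrite invr_ge0.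
pose mu : {measure set (n.-tuple bool * n.-tuple bool)%type -> \bar R} :=
  mscale (NngNum ck) (msum (fun i => \d_(nth w0 (enum W) i)) k).
have muE U : mu U = (k%:R^-1 * \sum_(w in W) \1_U w)%:E.
  rewrite /mu /mscale /= /msum EFinM; congr (_ * _)%E.
  rewrite -sumEFin -big_enum /= (big_nth w0) -cardE big_mkord.
  by apply: eq_bigr => i _.
have mu1 : mu setT = 1%E.
  rewrite muE; under eq_bigr do rewrite indicT.
  by rewrite sumr_const mulVf // pnatr_eq0 -lt0n.
(* Since [mu] has total mass 1, normalizing only packages it as a probability; [\d_w0] is the
   fallback for a degenerate mass and never arises. *)
exists (mnormalize mu \d_w0) => B Z b.
rewrite /prob_eq /= /mnormalize mu1 onee_eq0 /= invr1 mule1 muE /= mulrC.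
congr (_ / _); rewrite -sum1_card natr_sum.
rewrite [RHS](eq_bigl (fun w => (w \in W) && (Z w == b))); last first.
  by move=> w; rewrite inE.
rewrite big_mkcondr /=; apply: eq_bigr => w _; rewrite indicE.
have -> : (w \in [set w | Z w = b]%classic) = (Z w == b).
  by apply/idP/eqP; rewrite inE.
by case: eqP.
Qed.

Lemma log2_natX (R : realType) (k : nat) : log2 (2 ^+ k : R) = k%:R.
Proof.
by rewrite /log2 lnXn // -(mulr_natl (ln 2)) mulfK // gt_eqF // ln_gt0 // ltr1n.
Qed.

Lemma ler_log2 (R : realType) (x y : R) : 0 < x -> x <= y -> log2 x <= log2 y.
Proof.
move=> x0 xy; rewrite /log2 ler_pM2r ?invr_gt0 ?ln_gt0 ?ltr1n //.
by rewrite ler_ln // posrE // (lt_le_trans x0).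
Qed.

Lemma log2_div_natX (R : realType) (i j : nat) :
  log2 (2 ^+ i / 2 ^+ j : R) = i%:R - j%:R.
Proof.
by rewrite -(log2_natX R i) -(log2_natX R j) /log2 ln_div ?posrE ?exprn_gt0 // mulrBl.
Qed.

(** A quotient of two powers, rather than a power of a truncated difference, keeps the bound exact
    when [j] exceeds [i], as happens if [alpha > n]. *)
Lemma ge_min_entropy d (T : measurableType d) (R : realType)
    (P : probability T R) (A : finType) (Z : T -> A) (i j : nat) :
  (forall a, prob_eq P Z a <= 2 ^+ j / 2 ^+ i) ->
  ((i%:R - j%:R)%:E <= min_entropy P Z)%E.
Proof.
move=> PZ; apply/bigmin_geP; split=> [|a Pa]; first exact: leey.
rewrite lee_fin -log2_div_natX; apply: ler_log2.
  by rewrite divr_gt0 // exprn_gt0.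
by rewrite div1r -[leLHS]invrK lef_pV2 ?posrE ?invr_gt0 ?divr_gt0 ?exprn_gt0 ?invf_div.
Qed.

(** One outcome suffices: the positive lower bound on its probability also places it among the
    indices of the minimum. *)
Lemma min_entropy_le d (T : measurableType d) (R : realType)
    (P : probability T R) (A : finType) (Z : T -> A) (i j : nat) (a : A) :
  2 ^+ j / 2 ^+ i <= prob_eq P Z a ->
  (min_entropy P Z <= (i%:R - j%:R)%:E)%E.
Proof.
move=> PZ; have q0 : 0 < 2 ^+ j / 2 ^+ i :> R by rewrite divr_gt0 // exprn_gt0.
have Pa : 0 < prob_eq P Z a by exact: lt_le_trans PZ.
apply: (@le_trans _ _ (log2 (1 / prob_eq P Z a))%:E).
  exact: bigmin_le_cond.
rewrite lee_fin -log2_div_natX; apply: ler_log2; first by rewrite div1r invr_gt0.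
by rewrite div1r -[leRHS]invrK lef_pV2 ?posrE ?invr_gt0 ?divr_gt0 ?exprn_gt0 ?invf_div.
Qed.

(** Pigeonhole: the fibres partition [A], and each is at most as large as a largest one. *)
Lemma exists_large_fiber (A B : finType) (f : A -> B) :
  (0 < #|B|)%N -> exists b, (#|A| <= #|B| * #|[set a | f a == b]|)%N.
Proof.
move=> /card_gt0P [b0 _].
exists [arg max_(b > b0) #|[set a | f a == b]|].
case: arg_maxnP => // b _ bmax.
rewrite -[leqLHS]sum1_card (partition_big f (mem B)) //= -sum_nat_const.
apply: leq_sum => c _.
by rewrite sum1_card (leq_trans _ (bmax c isT)) // cardsE.
Qed.

Lemma exists_superset_card (A : finType) (S : {set A}) (k : nat) :
  (#|S| <= k <= #|A|)%N -> exists2 W : {set A}, S \subset W & #|W| = k.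
Proof.
case/andP=> + kA; elim: k kA => [|k IH] kA.
  by rewrite leqn0 => /eqP S0; exists S.
rewrite leq_eqVlt => /predU1P [Sk|]; first by exists S.
rewrite ltnS => /(IH (ltnW kA)) [W SW Wk].
have /fintype.subsetPn [x _ xW] : ~~ ([set: A] \subset W).
  by apply: contraL kA => /subset_leq_card; rewrite cardsT Wk -leqNgt.
exists (x |: W); first by exact: fintype.subset_trans SW (finset.subsetU1 x W).
by rewrite cardsU1 xW Wk.
Qed.

(* If alpha > N, the truncated N - alpha makes 2 ^ (N - alpha) equal to 1, which
   is still the right threshold since the support W must be nonempty. *)
Lemma exists_support (A B : finType) (f : A -> B) (N m alpha : nat) :
  #|A| = (2 ^ N)%N -> #|B| = (2 ^ m)%N -> (alpha <= m)%N ->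
  exists (W : {set A}) (b : B),
    [/\ (0 < #|W|)%N, (2 ^ N <= 2 ^ alpha * #|W|)%N
      & (2 ^ alpha * #|W| <= 2 ^ m * #|[set w in W | f w == b]|)%N].
Proof.
move=> cA cB am.
have [b] : exists b, (#|A| <= #|B| * #|[set a | f a == b]|)%N.
  by apply: exists_large_fiber; rewrite cB expn_gt0.
set S := [set a | f a == b]; rewrite cA cB => leS.
have S0 : (0 < #|S|)%N.
  by move: leS; case: #|S| => //; rewrite muln0 leqn0 expn_eq0.
have fS (W : {set A}) : S \subset W -> [set w in W | f w == b] = S.
  move=> /fintype.subsetP SW; apply/setP => w; rewrite !inE andb_idl // => fw.
  by apply: SW; rewrite inE.
have [leSk|ltkS] := leqP #|S| (2 ^ (N - alpha))%N.
  have [|W SW cW] := @exists_superset_card _ S (2 ^ (N - alpha))%N.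
    by rewrite leSk cA leq_exp2l // leq_subr.
  exists W, b; rewrite fS // cW -expnD expn_gt0; split=> //.
    by rewrite leq_exp2l // -leq_subLR.
  (* The left side is 2 to the power max([alpha], [N]). If it is [N], this is [leS]; if it is
     [alpha], use [alpha <= m] and that [S] is nonempty. *)
  rewrite -maxnE; have [_ //|_] := leqP alpha N.
  by rewrite (leq_trans (_ : _ <= 2 ^ m)%N) ?leq_exp2l // leq_pmulr.
exists S, b; rewrite fS //; split=> //; last by rewrite leq_mul2r leq_exp2l // am orbT.
apply: (@leq_trans (2 ^ alpha * 2 ^ (N - alpha))%N).
  by rewrite -expnD leq_exp2l // -leq_subLR.
by rewrite leq_mul2l ltnW ?orbT.
Qed.

Theorem theorem3 (R : realType) (n m alpha : nat)
    (f : n.-tuple bool * n.-tuple bool -> m.-tuple bool)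
    (le_alpha_m : (alpha <= m)%N) :
  exists (d : measure_display) (T : measurableType d) (P : probability T R)
         (X Y : {RV P >-> n.-tuple bool}),
    [/\ ((n%:R - alpha%:R)%:E <= min_entropy P X)%E,
        ((n%:R - alpha%:R)%:E <= min_entropy P Y)%E,
        (((2 * n)%:R - alpha%:R)%:E <= min_entropy P (fun w => (X w, Y w)))%E &
        (min_entropy P (fun w => f (X w, Y w)) <= (m%:R - alpha%:R)%:E)%E].
Proof.
have cT k : #|{: k.-tuple bool}| = (2 ^ k)%N by rewrite card_tuple card_bool.
have cTT : #|{: n.-tuple bool * n.-tuple bool}| = (2 ^ (2 * n))%N.
  by rewrite card_prod cT mul2n -addnn expnD.
have [W [b [W0 leW leb]]] := exists_support f cTT (cT m) le_alpha_m.
have [P PE] := exists_uniform_probability R W0.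
have W0R : 0 < #|W|%:R :> R by rewrite ltr0n.
(* With denominators cleared, [leW] leaves only a count for each lower bound: every fibre of [Z] in
   [W] has at most 2^(2n-i) points. *)
have PE2 (B : finType) (Z : n.-tuple bool * n.-tuple bool -> B) i :
    (forall a, #|[set w in W | Z w == a]| * 2 ^ i <= 2 ^ (2 * n))%N ->
    ((i%:R - alpha%:R)%:E <= min_entropy P Z)%E.
  move=> cZ; apply: ge_min_entropy => a; rewrite PE.
  rewrite ler_pdivrMr // mulrAC ler_pdivlMr ?exprn_gt0 //.
  by rewrite -!natrX -!natrM ler_nat (leq_trans (cZ a)).
pose X : {RV P >-> n.-tuple bool} :=
  mfun_Sub (mem_set (@measurable_fst _ _ (n.-tuple bool) (n.-tuple bool))).
pose Y : {RV P >-> n.-tuple bool} :=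
  mfun_Sub (mem_set (@measurable_snd _ _ (n.-tuple bool) (n.-tuple bool))).
have XY : (fun w => (X w, Y w)) = id by apply/funext => -[].
exists _, _, P, X, Y; split.
(* Points of [W] with first coordinate [x] are told apart by [snd], so there are at most 2^n of
   them; the case of [Y] is symmetric. *)
- apply: PE2 => x; rewrite mul2n -addnn expnD leq_mul2r; apply/orP; right.
  rewrite -cT -(card_in_imset (f := snd)) ?max_card //.
  by move=> [u v] [u' v']; rewrite !inE /= => /andP[_ /eqP ->] /andP[_ /eqP ->] ->.
- apply: PE2 => y; rewrite mul2n -addnn expnD leq_mul2r; apply/orP; right.
  rewrite -cT -(card_in_imset (f := fst)) ?max_card //.
  by move=> [u v] [u' v']; rewrite !inE /= => /andP[_ /eqP ->] /andP[_ /eqP ->] ->.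
- rewrite XY; apply: PE2 => w; rewrite -[leqRHS]mul1n leq_mul2r; apply/orP; right.
  by rewrite -(cards1 w) subset_leq_card //; apply/fintype.subsetP => u; rewrite !inE => /andP[].
- rewrite (_ : (fun w => _) = f); last by apply/funext => -[].
  apply: (@min_entropy_le _ _ _ _ _ _ _ _ b); rewrite PE.
  rewrite ler_pdivlMr // mulrAC ler_pdivrMr ?exprn_gt0 //.
  by rewrite -!natrX -!natrM ler_nat [leqRHS]mulnC.
Qed.
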